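(* Let $(\mathfrak g,[\cdot,\cdot,\cdot],\alpha,\beta)$ be a 3-Bihom-Lie superalgebra over a field $\mathbb K$ and $(M,\rho,\alpha_M,\beta_M)$ a representation of $\mathfrak g$. Assume that the maps $\alpha$ and $\beta_M$ are surjective. Then $\mathfrak g\ltimes M:=(\mathfrak g\oplus M,[\cdot,\cdot,\cdot]_\rho,\alpha+\alpha_M,\beta+\beta_M)$ is a 3-Bihom-Lie superalgebra, where $\alpha+\alpha_M,\ \beta+\beta_M:\mathfrak g\oplus M\to\mathfrak g\oplus M$ are defined by $(\alpha+\alpha_M)(u+x)=\alpha(u)+\alpha_M(x)$ and $(\beta+\beta_M)(u+x)=\beta(u)+\beta_M(x)$, and the bracket $[\cdot,\cdot,\cdot]_\rho$ is defined by $$[u+x,v+y,w+z]_\rho=[u,v,w]+\rho(u,v)(z)-(-1)^{|v||w|}\rho(u,\alpha^{-1}\beta(w))(\alpha_M\beta_M^{-1}(y))+(-1)^{|u|(|v|+|w|)}\rho(v,\alpha^{-1}\beta(w))(\alpha_M\beta_M^{-1}(x))$$ for all $u,v,w\in\mathfrak g$ and $x,y,z\in M$. ($\mathfrak g\ltimes M$ is called the semidirect product of the 3-Bihom-Lie superalgebra $(\mathfrak g,[\cdot,\cdot,\cdot],\alpha,\beta)$ and $M$.)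
   Context: For a homogeneous element $x$, $|x|\in\mathbb Z_2$ denotes its degree; identities involving $|x|$ are for homogeneous elements. $\mathfrak g\oplus M$ is the direct sum of $\mathbb Z_2$-graded spaces, and the bracket formula is for homogeneous $u+x,v+y,w+z$. A 3-Bihom-Lie superalgebra over $\mathbb K$ is a quadruple $(\mathfrak g,[\cdot,\cdot,\cdot],\alpha,\beta)$ consisting of a $\mathbb Z_2$-graded vector space $\mathfrak g=\mathfrak g_0\oplus\mathfrak g_1$, an even trilinear map $[\cdot,\cdot,\cdot]:\mathfrak g\otimes\mathfrak g\otimes\mathfrak g\to\mathfrak g$ and two even endomorphisms $\alpha,\beta:\mathfrak g\to\mathfrak g$ such that for all $x,y,z,u,v\in\mathfrak g$: (1) $\alpha\circ\beta=\beta\circ\alpha$; (2) $\alpha([x,y,z])=[\alpha(x),\alpha(y),\alpha(z)]$ and $\beta([x,y,z])=[\beta(x),\beta(y),\beta(z)]$; (3) $[\beta(x),\beta(y),\alpha(z)]=-(-1)^{|x||y|}[\beta(y),\beta(x),\alpha(z)]=-(-1)^{|y||z|}[\beta(x),\beta(z),\alpha(y)]$; (4) $[\beta^2(x),\beta^2(y),[\beta(z),\beta(u),\alpha(v)]]=(-1)^{(|u|+|v|)(|x|+|y|+|z|)}[\beta^2(u),\beta^2(v),[\beta(x),\beta(y),\alpha(z)]]-(-1)^{(|z|+|v|)(|x|+|y|)+|u||v|}[\beta^2(z),\beta^2(v),[\beta(x),\beta(y),\alpha(u)]]+(-1)^{(|z|+|u|)(|x|+|y|)}[\beta^2(z),\beta^2(u),[\beta(x),\beta(y),\alpha(v)]]$.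 A representation of $\mathfrak g$ is a 4-tuple $(M,\rho,\alpha_M,\beta_M)$ where $M$ is a vector superspace, $\alpha_M,\beta_M\in\mathrm{End}(M)$ are two commuting linear maps and $\rho:\mathfrak g\times\mathfrak g\to\mathrm{End}(M)$ is a super-skewsymmetric bilinear map ($\rho(u,v)=-(-1)^{|u||v|}\rho(v,u)$) such that for all $u,v,x,y\in\mathfrak g$: (R1) $\rho(\alpha(u),\alpha(v))\circ\alpha_M=\alpha_M\circ\rho(u,v)$; (R2) $\rho(\beta(u),\beta(v))\circ\beta_M=\beta_M\circ\rho(u,v)$; (R3) $\rho(\alpha\beta(u),\alpha\beta(v))\circ\rho(x,y)=(-1)^{(|u|+|v|)(|x|+|y|)}\rho(\beta(x),\beta(y))\circ\rho(\alpha(u),\alpha(v))+\rho([\beta(u),\beta(v),x],\beta(y))\circ\beta_M+(-1)^{|x|(|u|+|v|)}\rho(\beta(x),[\beta(u),\beta(v),y])\circ\beta_M$; (R4) $\rho([\beta(u),\beta(v),x],\beta(y))\circ\beta_M=(-1)^{|u|(|x|+|v|)}\rho(\alpha\beta(v),\beta(x))\circ\rho(\alpha(u),y)+(-1)^{|x|(|u|+|v|)}\rho(\beta(x),\alpha\beta(u))\circ\rho(\alpha(v),y)+\rho(\alpha\beta(u),\alpha\beta(v))\circ\rho(x,y)$.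
   Formalization: Surjectivity alone does not define α⁻¹, β_M⁻¹ and the claim can fail; it is assumed that ρ(u,α⁻¹β(w))(α_Mβ_M⁻¹(y)) does not depend on the preimages chosen (automatic if α, β_M are bijective), and that α_M, β_M and ρ are even, as the conclusion requires. *)

(* Defs.v *)
From HB Require Import structures.
From mathcomp Require Import all_boot all_order all_algebra.

Set Implicit Arguments.
Unset Strict Implicit.
Unset Printing Implicit Defensive.

Import GRing.Theory.
Local Open Scope ring_scope.

(* A Z_2-grading V = V_0 (+) V_1 is recorded by its two component projections;
   the degrees 0 and 1 are encoded as false and true. *)
Record superspace (K : fieldType) := Superspace {
  carrier :> lmodType K;
  component : bool -> carrier -> carrier;
  component_linear : forall i, linear (component i);
  component_component : forall i j x,
    component i (component j x) = if i == j then component j x else 0;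
  component_sum : forall x, component false x + component true x = x
}.

(* [homog i x] is x \in V_i; in particular 0 is homogeneous of both degrees. *)
Definition homog (K : fieldType) (V : superspace K) (i : bool) (x : V) : Prop :=
  component i x = x.

Definition even_map (K : fieldType) (V W : superspace K) (f : V -> W) : Prop :=
  forall i x, homog i x -> homog i (f x).

Section DirectSum.
Variables (K : fieldType) (V W : superspace K).

Definition dsum_component (i : bool) (x : V * W) : V * W :=
  (component i x.1, component i x.2).

Lemma dsum_component_linear i : linear (dsum_component i).
Proof. by move=> a [u x] [v y]; congr pair; exact: component_linear. Qed.

Lemma dsum_component_component i j x :
  dsum_component i (dsum_component j x) =
  if i == j then dsum_component j x else 0.
Proof. by rewrite /dsum_component /= !component_component; case: (i == j). Qed.

Lemma dsum_component_sum x : dsum_component false x + dsum_component true x = x.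
Proof. by case: x => u x; congr pair; exact: component_sum. Qed.

Definition dsum : superspace K :=
  @Superspace K (V * W)%type dsum_component
    dsum_component_linear dsum_component_component dsum_component_sum.

Definition dsum_map (f : V -> V) (h : W -> W) (x : dsum) : dsum :=
  (f x.1, h x.2).

End DirectSum.

(* In the signs below a degree i : bool is used as the exponent 0 or 1. *)
Record bihom_lie3_superalgebra (K : fieldType) (g : superspace K)
    (br : g -> g -> g -> g) (alpha beta : g -> g) : Prop := {
  br_linear1 : forall y z, linear (fun x => br x y z);
  br_linear2 : forall x z, linear (fun y => br x y z);
  br_linear3 : forall x y, linear (fun z => br x y z);
  br_even : forall i j k x y z, homog i x -> homog j y -> homog k z ->
    homog (i (+) j (+) k) (br x y z);
  alpha_linear : linear alpha;
  alpha_even : even_map alpha;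
  beta_linear : linear beta;
  beta_even : even_map beta;
  alpha_betaC : forall x, alpha (beta x) = beta (alpha x);
  alpha_br : forall x y z,
    alpha (br x y z) = br (alpha x) (alpha y) (alpha z);
  beta_br : forall x y z,
    beta (br x y z) = br (beta x) (beta y) (beta z);
  br_skew12 : forall (i j k : bool) x y z,
    homog i x -> homog j y -> homog k z ->
    br (beta x) (beta y) (alpha z)
    = - ((-1) ^+ (i * j)%N *: br (beta y) (beta x) (alpha z));
  br_skew23 : forall (i j k : bool) x y z,
    homog i x -> homog j y -> homog k z ->
    br (beta x) (beta y) (alpha z)
    = - ((-1) ^+ (j * k)%N *: br (beta x) (beta z) (alpha y));
  br_jacobi : forall (dx dy dz du dv : bool) x y z u v,
    homog dx x -> homog dy y -> homog dz z -> homog du u -> homog dv v ->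
    br (beta (beta x)) (beta (beta y)) (br (beta z) (beta u) (alpha v))
    = (-1) ^+ ((du + dv) * (dx + dy + dz))%N *:
        br (beta (beta u)) (beta (beta v)) (br (beta x) (beta y) (alpha z))
      - (-1) ^+ ((dz + dv) * (dx + dy) + du * dv)%N *:
        br (beta (beta z)) (beta (beta v)) (br (beta x) (beta y) (alpha u))
      + (-1) ^+ ((dz + du) * (dx + dy))%N *:
        br (beta (beta z)) (beta (beta u)) (br (beta x) (beta y) (alpha v))
}.

(* [rho u v] is an endomorphism of M.  As usual for superspaces, alpha_M and
   beta_M are even and rho is even, i.e. rho(u,v) has degree |u|+|v|; otherwise
   the semidirect product would not have even structure maps. *)
Record representation (K : fieldType) (g : superspace K)
    (br : g -> g -> g -> g) (alpha beta : g -> g)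
    (M : superspace K) (rho : g -> g -> M -> M) (alphaM betaM : M -> M)
    : Prop := {
  alphaM_linear : linear alphaM;
  alphaM_even : even_map alphaM;
  betaM_linear : linear betaM;
  betaM_even : even_map betaM;
  alphaM_betaMC : forall m, alphaM (betaM m) = betaM (alphaM m);
  rho_linear1 : forall v m, linear (fun u => rho u v m);
  rho_linear2 : forall u m, linear (fun v => rho u v m);
  rho_linear3 : forall u v, linear (rho u v);
  rho_even : forall i j k u v m, homog i u -> homog j v -> homog k m ->
    homog (i (+) j (+) k) (rho u v m);
  rho_skew : forall (i j : bool) u v m, homog i u -> homog j v ->
    rho u v m = - ((-1) ^+ (i * j)%N *: rho v u m);
  rho_alpha : forall u v m,
    rho (alpha u) (alpha v) (alphaM m) = alphaM (rho u v m);
  rho_beta : forall u v m,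
    rho (beta u) (beta v) (betaM m) = betaM (rho u v m);
  rho_rho : forall (du dv dx dy : bool) u v x y m,
    homog du u -> homog dv v -> homog dx x -> homog dy y ->
    rho (alpha (beta u)) (alpha (beta v)) (rho x y m)
    = (-1) ^+ ((du + dv) * (dx + dy))%N *:
        rho (beta x) (beta y) (rho (alpha u) (alpha v) m)
      + rho (br (beta u) (beta v) x) (beta y) (betaM m)
      + (-1) ^+ (dx * (du + dv))%N *:
        rho (beta x) (br (beta u) (beta v) y) (betaM m);
  rho_br : forall (du dv dx dy : bool) u v x y m,
    homog du u -> homog dv v -> homog dx x -> homog dy y ->
    rho (br (beta u) (beta v) x) (beta y) (betaM m)
    = (-1) ^+ (du * (dx + dv))%N *:
        rho (alpha (beta v)) (beta x) (rho (alpha u) y m)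
      + (-1) ^+ (dx * (du + dv))%N *:
        rho (beta x) (alpha (beta u)) (rho (alpha v) y m)
      + rho (alpha (beta u)) (alpha (beta v)) (rho x y m)
}.

Section Preimage.
Variables (A : choiceType) (B : eqType) (f : A -> B).

Definition surjective : Prop := forall b, exists a, f a = b.

Lemma surjective_eqb : surjective -> forall b, exists a, f a == b.
Proof. by move=> fS b; have [a <-] := fS b; exists a. Qed.

Definition preimage (fS : surjective) (b : B) : A :=
  xchoose (surjective_eqb fS b).

Lemma preimageK (fS : surjective) : cancel (preimage fS) f.
Proof. by move=> b; apply/eqP; exact: (xchooseP (surjective_eqb fS b)). Qed.

End Preimage.

Section SemidirectProduct.
Variables (K : fieldType) (g M : superspace K).
Variables (br : g -> g -> g -> g) (alpha beta : g -> g).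
Variables (rho : g -> g -> M -> M) (alphaM betaM : M -> M).

(* Surjectivity alone does not determine alpha^-1 and beta_M^-1: this says that
   rho(u, alpha^-1 beta(w)) (alpha_M beta_M^-1(m)) does not depend on the
   preimages chosen.  It is automatic when alpha and beta_M are injective. *)
Definition preimage_independent : Prop :=
  forall u w a a' m m', alpha a = beta w -> alpha a' = beta w ->
    betaM m = betaM m' -> rho u a (alphaM m) = rho u a' (alphaM m').

Lemma injective_preimage_independent :
  injective alpha -> injective betaM -> preimage_independent.
Proof. by move=> aI bI u w a a' m m' <- /aI-> /bI->. Qed.

Hypotheses (alphaS : surjective alpha) (betaMS : surjective betaM).
Let alphaV := preimage alphaS.
Let betaMV := preimage betaMS.

Definition semidirect_bracket_homog (i j k : bool) (X Y Z : dsum g M)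
    : dsum g M :=
  let: (u, x) := X in let: (v, y) := Y in let: (w, z) := Z in
  (br u v w,
   rho u v z
   - (-1) ^+ (j * k)%N *: rho u (alphaV (beta w)) (alphaM (betaMV y))
   + (-1) ^+ (i * (j + k))%N *: rho v (alphaV (beta w)) (alphaM (betaMV x))).

(* The formula for homogeneous arguments of degrees i, j, k, extended to all
   of g (+) M by additivity; see semidirect_bracketE below. *)
Definition semidirect_bracket (X Y Z : dsum g M) : dsum g M :=
  \sum_(i : bool) \sum_(j : bool) \sum_(k : bool)
    semidirect_bracket_homog i j k
      (component i X) (component j Y) (component k Z).

Hypotheses (g_alg : bihom_lie3_superalgebra br alpha beta).
Hypotheses (M_rep : representation br alpha beta rho alphaM betaM).
Hypothesis (indep : preimage_independent).

Let lin0 (U V : lmodType K) (f : U -> V) : linear f -> f 0 = 0.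
Proof. by move=> /(_ (-1) 0 0); rewrite !scaler0 addr0 scaleN1r addNr. Qed.

Let rho0l v m : rho 0 v m = 0.
Proof. exact: (lin0 (rho_linear1 M_rep v m)). Qed.

Let rho0m u m : rho u 0 m = 0.
Proof. exact: (lin0 (rho_linear2 M_rep u m)). Qed.

Let rho0r u v : rho u v 0 = 0.
Proof. exact: (lin0 (rho_linear3 M_rep u v)). Qed.

Let rhoV0 u w : rho u (alphaV (beta w)) (alphaM (betaMV 0)) = 0.
Proof.
rewrite (indep u (w := w) (a' := alphaV (beta w)) (m' := 0)) ?preimageK //.
  by rewrite (lin0 (alphaM_linear M_rep)) rho0r.
by rewrite (lin0 (betaM_linear M_rep)).
Qed.

Let rho0V u m : rho u (alphaV (beta 0)) (alphaM m) = 0.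
Proof.
rewrite (indep u (w := 0) (a' := 0) (m' := m)) ?preimageK ?rho0m //.
by rewrite (lin0 (beta_linear g_alg)) (lin0 (alpha_linear g_alg)).
Qed.

Lemma semidirect_bracketE (i j k : bool) (X Y Z : dsum g M) :
  homog i X -> homog j Y -> homog k Z ->
  semidirect_bracket X Y Z = semidirect_bracket_homog i j k X Y Z.
Proof.
have neqE l l' (W : dsum g M) : homog l W ->
    component l' W = if l' == l then W else 0.
  by move=> Wl; rewrite -{1}Wl component_component Wl.
have h0l a b c (Y' Z' : dsum g M) : semidirect_bracket_homog a b c 0 Y' Z' = 0.
  case: Y' Z' => [v y] [w z]; congr pair.
    exact: (lin0 (br_linear1 g_alg v w)).
  by rewrite !rho0l rhoV0 !scaler0 subr0 addr0.
have h0m a b c (X' Z' : dsum g M) : semidirect_bracket_homog a b c X' 0 Z' = 0.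
  case: X' Z' => [u x] [w z]; congr pair.
    exact: (lin0 (br_linear2 g_alg u w)).
  by rewrite !rho0m !rho0l rhoV0 !scaler0 subr0 addr0.
have h0r a b c (X' Y' : dsum g M) : semidirect_bracket_homog a b c X' Y' 0 = 0.
  case: X' Y' => [u x] [v y]; congr pair.
    exact: (lin0 (br_linear3 g_alg u v)).
  by rewrite rho0r !rho0V !scaler0 subr0 addr0.
have pick l (W : dsum g M) (F : bool -> dsum g M -> dsum g M) :
    homog l W -> (forall a, F a 0 = 0) ->
    \sum_(a : bool) F a (component a W) = F l W.
  move=> Wl F0; under eq_bigr => a _ do rewrite (neqE _ a _ Wl).
  rewrite (bigD1 l) //= eqxx big1 ?addr0 // => a /negPf->.
  by rewrite F0.
move=> Xi Yj Zk; rewrite /semidirect_bracket.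
etransitivity.
  apply: (pick i X (fun a X' => \sum_b \sum_c semidirect_bracket_homog a b c X'
    (component b Y) (component c Z)) Xi) => a.
  by rewrite big1 // => b _; rewrite big1 // => c _; rewrite h0l.
etransitivity.
  apply: (pick j Y (fun b Y' => \sum_c semidirect_bracket_homog i b c X Y'
    (component c Z)) Yj) => b.
  by rewrite big1 // => c _; rewrite h0m.
by apply: (pick k Z (fun c Z' => semidirect_bracket_homog i j c X Y Z') Zk).
Qed.

End SemidirectProduct.

(* Main.v *)
(** Independence of the preimages makes
    T(u,w,m) = rho(u, alpha^-1 beta(w)) (alpha_M beta_M^-1(m)) trilinear, even
    and compatible with the structure maps, which gives every axiom but the
    Jacobi identity at once.  For the latter write x = alpha(x'), y = alpha(y'),
    z = alpha(z'), u = alpha(u') by surjectivity.  The M-part is a sum of terms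
    linear in one of the five M-components of the arguments.  The terms in those
    of the last three arguments cancel by (R3) applied to beta(x'), beta(y');
    the terms in those of the first two cancel by (R4) applied to beta(z'),
    beta(u'). *)
Require Import Defs.
From mathcomp Require Import all_boot all_order all_algebra.

Set Implicit Arguments.
Unset Strict Implicit.
Unset Printing Implicit Defensive.

Import GRing.Theory.
Local Open Scope ring_scope.

(** * Linear maps given by the unbundled predicate [linear] *)

Section LinearMaps.
Variables (K : fieldType) (U V : lmodType K) (f : U -> V).
Hypothesis fL : linear f.

Lemma linear_add x y : f (x + y) = f x + f y.
Proof. by rewrite -{1}[x]scale1r fL scale1r. Qed.

Lemma linear_zero : f 0 = 0.
Proof. by apply: (addrI (f 0)); rewrite -linear_add !addr0. Qed.

Lemma linear_scale a x : f (a *: x) = a *: f x.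
Proof. by rewrite -[a *: x]addr0 fL linear_zero addr0. Qed.

Lemma linear_opp x : f (- x) = - f x.
Proof. by rewrite -scaleN1r linear_scale scaleN1r. Qed.

Lemma linear_bigsum (I : finType) (F : I -> U) : f (\sum_i F i) = \sum_i f (F i).
Proof. exact: (big_morph f linear_add linear_zero). Qed.

End LinearMaps.

(** * Homogeneous elements and even maps *)

Section Superspaces.
Variables (K : fieldType).
Implicit Types V W : superspace K.

Lemma homog_component V i (x : V) : homog i (component i x).
Proof. by rewrite /homog component_component eqxx. Qed.

Lemma homog_add V i (x y : V) : homog i x -> homog i y -> homog i (x + y).
Proof.
by rewrite /homog => xi yi; rewrite (linear_add (@component_linear _ V i)) xi yi.
Qed.

Lemma homog_scale V i a (x : V) : homog i x -> homog i (a *: x).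
Proof.
by rewrite /homog => xi; rewrite (linear_scale (@component_linear _ V i)) xi.
Qed.

Lemma homog_opp V i (x : V) : homog i x -> homog i (- x).
Proof. by rewrite -scaleN1r; apply: homog_scale. Qed.

Lemma homog_dsum V W i (X : dsum V W) : homog i X <-> homog i X.1 /\ homog i X.2.
Proof. by case: X => u x; split=> [[]|[ui xi]] //; congr pair. Qed.

(** Evenness puts the images of the two components of [x] in different degrees, so projecting [f x]
    keeps exactly one of them. *)
Lemma even_component V W (f : V -> W) i x :
  linear f -> even_map f -> component i (f x) = f (component i x).
Proof.
move=> fL fE; have cL := @component_linear _ W i.
rewrite -{1}[x]component_sum (linear_add fL) (linear_add cL).
rewrite -(fE _ _ (homog_component false x)) -(fE _ _ (homog_component true x)).
rewrite !component_component.
by case: i {cL}; rewrite /= ?addr0 ?add0r fE //; apply: homog_component.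
Qed.

(** The degree [i] component of any preimage works, because [f] commutes with the projections. *)
Lemma homog_preimage V W (f : V -> W) i y :
  linear f -> even_map f -> surjective f -> homog i y ->
  exists2 x, homog i x & f x = y.
Proof.
move=> fL fE fS yi; have [x fx] := fS y; exists (component i x).
  exact: homog_component.
by rewrite -even_component // fx.
Qed.

Lemma dsum_map_linear V W (f : V -> V) (h : W -> W) :
  linear f -> linear h -> linear (dsum_map f h).
Proof. by move=> fL hL a X Y; congr pair; [apply: fL | apply: hL]. Qed.

Lemma dsum_map_even V W (f : V -> V) (h : W -> W) :
  even_map f -> even_map h -> even_map (dsum_map f h).
Proof.
move=> fE hE i X /homog_dsum[X1 X2]; apply/homog_dsum.
by split; [apply: fE | apply: hE].
Qed.

End Superspaces.

Lemma signr_if (R : pzRingType) n : (-1) ^+ n = (if odd n then -1 else 1) :> R.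
Proof. by rewrite -signr_odd; case: (odd n). Qed.

Section SemidirectProduct.
Variables (K : fieldType) (g M : superspace K).
Variables (br : g -> g -> g -> g) (alpha beta : g -> g).
Variables (rho : g -> g -> M -> M) (alphaM betaM : M -> M).
Hypotheses (g_alg : bihom_lie3_superalgebra br alpha beta).
Hypotheses (M_rep : representation br alpha beta rho alphaM betaM).
Hypotheses (alphaS : surjective alpha) (betaMS : surjective betaM).
Hypothesis (indep : preimage_independent alpha beta rho alphaM betaM).

Let aL := alpha_linear g_alg.
Let bL := beta_linear g_alg.
Let aML := alphaM_linear M_rep.
Let bML := betaM_linear M_rep.
Let rho1 v m := rho_linear1 M_rep v m.
Let rho2 u m := rho_linear2 M_rep u m.
Let rho3 u v := rho_linear3 M_rep u v.

(** * The twisted action through preimages under [alpha] and [betaM] *)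

Definition twisted_rho u w m :=
  rho u (preimage alphaS (beta w)) (alphaM (preimage betaMS m)).

(** By [indep], any preimages may replace the chosen ones. Later proofs can therefore take linear
    combinations, homogeneous preimages, or images under the structure maps. *)
Lemma twisted_rhoE u w m a n : alpha a = beta w -> betaM n = m ->
  twisted_rho u w m = rho u a (alphaM n).
Proof. by move=> aw nm; apply: (indep u (w := w)); rewrite ?preimageK. Qed.

Lemma twisted_rho_linear1 w m : linear (fun u => twisted_rho u w m).
Proof. exact: rho1. Qed.

Lemma twisted_rho_linear2 u m : linear (fun w => twisted_rho u w m).
Proof.
move=> a w w'; rewrite -rho2.
(* [preimage] need not be linear, but the combination of the chosen preimages is a preimage of the
   combination. *)
by apply: twisted_rhoE; rewrite ?preimageK // aL bL !preimageK.
Qed.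

Lemma twisted_rho_linear3 u w : linear (twisted_rho u w).
Proof.
move=> a m m'; rewrite -rho3 -aML.
by apply: twisted_rhoE; rewrite ?preimageK // bML !preimageK.
Qed.

Lemma twisted_rho_even i j k u w m : homog i u -> homog j w -> homog k m ->
  homog (i (+) j (+) k) (twisted_rho u w m).
Proof.
move=> ui wj mk.
have [a aj aw] := homog_preimage aL (alpha_even g_alg) alphaS (beta_even g_alg wj).
have [n nk nm] := homog_preimage bML (betaM_even M_rep) betaMS mk.
rewrite (twisted_rhoE _ aw nm).
by apply: (rho_even M_rep) => //; apply: (alphaM_even M_rep).
Qed.

Lemma alphaM_twisted_rho u w m :
  alphaM (twisted_rho u w m) = twisted_rho (alpha u) (alpha w) (alphaM m).
Proof.
rewrite -(rho_alpha M_rep); apply/esym/twisted_rhoE.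
  by rewrite preimageK (alpha_betaC g_alg).
by rewrite -(alphaM_betaMC M_rep) preimageK.
Qed.

Lemma betaM_twisted_rho u w m :
  betaM (twisted_rho u w m) = twisted_rho (beta u) (beta w) (betaM m).
Proof.
rewrite -(rho_beta M_rep) -(alphaM_betaMC M_rep).
by apply/esym/twisted_rhoE; rewrite ?(alpha_betaC g_alg) preimageK.
Qed.

Local Notation sbr := (semidirect_bracket br beta rho alphaM alphaS betaMS).
Local Notation sbrh :=
  (semidirect_bracket_homog br beta rho alphaM alphaS betaMS).
Local Notation alphaD := (dsum_map alpha alphaM).
Local Notation betaD := (dsum_map beta betaM).

(** * Trilinearity and evenness of the bracket *)

Lemma semidirect_bracket_homogE i j k (X Y Z : dsum g M) :
  sbrh i j k X Y Z =
  (br X.1 Y.1 Z.1,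
   rho X.1 Y.1 Z.2
   - (-1) ^+ (j * k)%N *: twisted_rho X.1 Z.1 Y.2
   + (-1) ^+ (i * (j + k))%N *: twisted_rho Y.1 Z.1 X.2).
Proof. by case: X Y Z => [u x] [v y] [w z]. Qed.

Let regroup (a s t : K) (p p' q q' r r' : M) :
  (a *: p + p') - s *: (a *: q + q') + t *: (a *: r + r')
  = a *: (p - s *: q + t *: r) + (p' - s *: q' + t *: r').
Proof.
rewrite !scalerDr scalerN !scalerA [s * a]mulrC [t * a]mulrC opprD.
by rewrite [a *: p + p' + _]addrACA [LHS]addrACA.
Qed.

(** The degrees are fixed labels, not tied to the arguments, so the signs are constants and
    linearity holds on the whole space. *)
Lemma semidirect_bracket_homog_linear1 i j k Y Z :
  linear (fun X => sbrh i j k X Y Z).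
Proof.
move=> a X X'; rewrite !semidirect_bracket_homogE; congr pair => /=.
  exact: (br_linear1 g_alg).
by rewrite rho1 twisted_rho_linear1 twisted_rho_linear3 regroup.
Qed.

Lemma semidirect_bracket_homog_linear2 i j k X Z :
  linear (fun Y => sbrh i j k X Y Z).
Proof.
move=> a Y Y'; rewrite !semidirect_bracket_homogE; congr pair => /=.
  exact: (br_linear2 g_alg).
by rewrite rho2 twisted_rho_linear1 twisted_rho_linear3 regroup.
Qed.

Lemma semidirect_bracket_homog_linear3 i j k X Y :
  linear (fun Z => sbrh i j k X Y Z).
Proof.
move=> a Z Z'; rewrite !semidirect_bracket_homogE; congr pair => /=.
  exact: (br_linear3 g_alg).
by rewrite rho3 !twisted_rho_linear2 regroup.
Qed.

Lemma semidirect_bracket_linear1 Y Z : linear (fun X => sbr X Y Z).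
Proof.
move=> a X X'; rewrite /semidirect_bracket.
do 3!(rewrite scaler_sumr -big_split; apply: eq_bigr => ? _).
by rewrite component_linear semidirect_bracket_homog_linear1.
Qed.

Lemma semidirect_bracket_linear2 X Z : linear (fun Y => sbr X Y Z).
Proof.
move=> a Y Y'; rewrite /semidirect_bracket.
do 3!(rewrite scaler_sumr -big_split; apply: eq_bigr => ? _).
by rewrite component_linear semidirect_bracket_homog_linear2.
Qed.

Lemma semidirect_bracket_linear3 X Y : linear (fun Z => sbr X Y Z).
Proof.
move=> a Z Z'; rewrite /semidirect_bracket.
do 3!(rewrite scaler_sumr -big_split; apply: eq_bigr => ? _).
by rewrite component_linear semidirect_bracket_homog_linear3.
Qed.

Lemma semidirect_bracket_even i j k X Y Z :
  homog i X -> homog j Y -> homog k Z -> homog (i (+) j (+) k) (sbr X Y Z).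
Proof.
move=> Xi Yj Zk.
rewrite (semidirect_bracketE _ _ g_alg M_rep indep Xi Yj Zk).
rewrite semidirect_bracket_homogE.
have [[ui xi] [vj yj] [wk zk]] :
  [/\ homog i X.1 /\ homog i X.2, homog j Y.1 /\ homog j Y.2
    & homog k Z.1 /\ homog k Z.2] by split; apply/homog_dsum.
apply/homog_dsum; split=> /=; first exact: (br_even g_alg).
apply: homog_add; first apply: homog_add.
- exact: (rho_even M_rep).
- by apply/homog_opp/homog_scale; rewrite addbAC; apply: twisted_rho_even.
- by apply: homog_scale; rewrite -addbA addbC; apply: twisted_rho_even.
Qed.

(** * Compatibility with the structure maps *)

Let aDL : linear alphaD := dsum_map_linear aL aML.
Let bDL : linear betaD := dsum_map_linear bL bML.
Let aDE : even_map alphaD := dsum_map_even (alpha_even g_alg) (alphaM_even M_rep).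
Let bDE : even_map betaD := dsum_map_even (beta_even g_alg) (betaM_even M_rep).

(** An even linear [F] passes through the sums over degrees and the projections, which leaves only
    the formula with fixed labels to check. *)
Lemma semidirect_bracket_morph (F : dsum g M -> dsum g M) :
    linear F -> even_map F ->
    (forall i j k X Y Z,
      F (sbrh i j k X Y Z) = sbrh i j k (F X) (F Y) (F Z)) ->
  forall X Y Z, F (sbr X Y Z) = sbr (F X) (F Y) (F Z).
Proof.
move=> FL FE FM X Y Z; rewrite /semidirect_bracket.
do 3!(rewrite (linear_bigsum FL); apply: eq_bigr => ? _).
by rewrite FM !even_component.
Qed.

Lemma alpha_semidirect_bracket X Y Z :
  alphaD (sbr X Y Z) = sbr (alphaD X) (alphaD Y) (alphaD Z).
Proof.
apply: semidirect_bracket_morph => // i j k {}X {}Y {}Z.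
rewrite !semidirect_bracket_homogE; congr pair; first exact: (alpha_br g_alg).
rewrite /= !(linear_add aML) (linear_opp aML) !(linear_scale aML).
by rewrite !alphaM_twisted_rho (rho_alpha M_rep).
Qed.

Lemma beta_semidirect_bracket X Y Z :
  betaD (sbr X Y Z) = sbr (betaD X) (betaD Y) (betaD Z).
Proof.
apply: semidirect_bracket_morph => // i j k {}X {}Y {}Z.
rewrite !semidirect_bracket_homogE; congr pair; first exact: (beta_br g_alg).
rewrite /= !(linear_add bML) (linear_opp bML) !(linear_scale bML).
by rewrite !betaM_twisted_rho (rho_beta M_rep).
Qed.

(** All inverses disappear: [beta Z.1] is a preimage under [alpha] of [beta (alpha Z.1)], and
    [betaM] cancels in the first two arguments. The skewsymmetry and Jacobi axioms involve brackets
    of this form. *)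
Lemma semidirect_bracket_bba i j k X Y Z :
  homog i X -> homog j Y -> homog k Z ->
  sbr (betaD X) (betaD Y) (alphaD Z) =
  (br (beta X.1) (beta Y.1) (alpha Z.1),
   rho (beta X.1) (beta Y.1) (alphaM Z.2)
   - (-1) ^+ (j * k)%N *: rho (beta X.1) (beta Z.1) (alphaM Y.2)
   + (-1) ^+ (i * (j + k))%N *: rho (beta Y.1) (beta Z.1) (alphaM X.2)).
Proof.
move=> Xi Yj Zk.
have E := semidirect_bracketE _ _ g_alg M_rep indep
  (bDE Xi) (bDE Yj) (aDE Zk).
rewrite E semidirect_bracket_homogE /=.
have abZ := alpha_betaC g_alg Z.1.
by rewrite !(twisted_rhoE _ abZ (erefl _)).
Qed.


(** * Signs and super-skewsymmetry *)

Local Ltac expand_signs := rewrite !(scalerDr, scalerN, scalerA, opprD, opprK).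

(** A sign depends only on the parity of its exponent, so a sign identity is a finite check over the
    degrees. A prior [clear] leaves the degrees free to be split. *)
Local Ltac sign_cases :=
  rewrite !signr_if !(oddD, oddM, oddb);
  repeat match goal with b : bool |- _ => destruct b end;
  rewrite /= ?(mulrN, mulNr, mulr1, opprK).

Lemma semidirect_bracket_skew12 (i j k : bool) X Y Z :
  homog i X -> homog j Y -> homog k Z ->
  sbr (betaD X) (betaD Y) (alphaD Z)
  = - ((-1) ^+ (i * j)%N *: sbr (betaD Y) (betaD X) (alphaD Z)).
Proof.
move=> Xi Yj Zk; rewrite (semidirect_bracket_bba Xi Yj Zk).
rewrite (semidirect_bracket_bba Yj Xi Zk).
have [[ui _] [vj _] [wk _]] :
  [/\ homog i X.1 /\ homog i X.2, homog j Y.1 /\ homog j Y.2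
    & homog k Z.1 /\ homog k Z.2] by split; apply/homog_dsum.
congr pair => /=; first exact: (br_skew12 g_alg ui vj wk).
have bui := beta_even g_alg ui; have bvj := beta_even g_alg vj.
rewrite (rho_skew M_rep _ bui bvj); expand_signs.
(* The swap exchanges the terms in [X.2] and [Y.2]; only the term in [Z.2] needed [rho_skew]. *)
rewrite [RHS]addrAC -!scaleNr; congr (_ + _ *: _ + _ *: _).
  by clear; sign_cases.
by clear; sign_cases.
Qed.

Lemma semidirect_bracket_skew23 (i j k : bool) X Y Z :
  homog i X -> homog j Y -> homog k Z ->
  sbr (betaD X) (betaD Y) (alphaD Z)
  = - ((-1) ^+ (j * k)%N *: sbr (betaD X) (betaD Z) (alphaD Y)).
Proof.
move=> Xi Yj Zk; rewrite (semidirect_bracket_bba Xi Yj Zk).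
rewrite (semidirect_bracket_bba Xi Zk Yj).
have [[ui _] [vj _] [wk _]] :
  [/\ homog i X.1 /\ homog i X.2, homog j Y.1 /\ homog j Y.2
    & homog k Z.1 /\ homog k Z.2] by split; apply/homog_dsum.
congr pair => /=; first exact: (br_skew23 g_alg ui vj wk).
have bvj := beta_even g_alg vj; have bwk := beta_even g_alg wk.
(* The coefficient 1 makes each of the three terms a scalar times a vector, so that only scalars
   remain to be compared. *)
rewrite -[rho _ _ (alphaM Z.2)]scale1r (rho_skew M_rep _ bvj bwk); expand_signs.
rewrite [X in _ = X + _]addrC -!scaleNr; congr (_ *: _ + _ *: _ + _ *: _).
  by clear; sign_cases.
by clear; sign_cases.
Qed.

(** * The Jacobi identity *)

Definition nested_rho a b c d m :=
  rho (beta (beta a)) (beta (beta b)) (rho (beta c) (beta d) (alphaM m)).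

(* T(beta^2 a, [beta alpha x, beta alpha y, alpha c], beta_M^2 m) with alpha^-1
   and beta_M^-1 cancelled. *)
Definition rho_nested_br a x y c m :=
  rho (beta (beta a)) (br (beta (beta x)) (beta (beta y)) (beta c))
    (alphaM (betaM m)).

(** This is (R3) at [beta x], [beta y], [beta c], [beta d], with [rho_skew] moving the bracket into
    the second slot of [rho]. *)
Lemma nested_rhoE (dx dy dc dd : bool) x y c d m :
  homog dx x -> homog dy y -> homog dc c -> homog dd d ->
  nested_rho (alpha x) (alpha y) c d m
  = (-1) ^+ ((dx + dy) * (dc + dd))%N *: nested_rho c d (alpha x) (alpha y) m
    - (-1) ^+ (dd * (dx + dy + dc))%N *: rho_nested_br d x y c m
    + (-1) ^+ (dc * (dx + dy))%N *: rho_nested_br c x y d m.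
Proof.
move=> xh yh ch dh; have bE := beta_even g_alg.
have [bx by_ bc bd] := And4 (bE _ _ xh) (bE _ _ yh) (bE _ _ ch) (bE _ _ dh).
have brh := br_even g_alg (bE _ _ bx) (bE _ _ by_) bc.
rewrite /nested_rho /rho_nested_br -!(alpha_betaC g_alg).
rewrite (rho_rho M_rep _ bx by_ bc bd) !(alpha_betaC g_alg).
rewrite (rho_skew M_rep _ brh (bE _ _ bd)) (alphaM_betaMC M_rep).
rewrite -!scaleNr; congr (_ + _ *: _ + _).
by clear; sign_cases.
Qed.

(** This is (R4) at [beta z], [beta u], [beta v], [beta a]; skewsymmetry then orders the arguments
    as on the right of the Jacobi identity. *)
Lemma rho_nested_brE (da dz du dv : bool) a z u v m :
  homog da a -> homog dz z -> homog du u -> homog dv v ->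
  rho_nested_br a z u v m
  = (-1) ^+ ((da + dz) * (du + dv))%N *: nested_rho (alpha u) v a (alpha z) m
    - (-1) ^+ (da * (dz + dv) + du * dv)%N *:
      nested_rho (alpha z) v a (alpha u) m
    + (-1) ^+ (da * (dz + du))%N *: nested_rho (alpha z) (alpha u) a v m.
Proof.
move=> ah zh uh vh; have bE := beta_even g_alg; have aE := alpha_even g_alg.
have [ba bz bu bv] := And4 (bE _ _ ah) (bE _ _ zh) (bE _ _ uh) (bE _ _ vh).
have brh := br_even g_alg (bE _ _ bz) (bE _ _ bu) bv.
rewrite /rho_nested_br (rho_skew M_rep _ (bE _ _ ba) brh).
rewrite (alphaM_betaMC M_rep) (rho_br M_rep _ bz bu bv ba) /nested_rho.
have sk := rho_skew M_rep.
rewrite (sk _ _ (beta (beta v)) _ _ (bE _ _ bv) (aE _ _ (bE _ _ bz))).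
rewrite (sk _ _ (alpha (beta z)) _ _ (aE _ _ bz) ba).
rewrite (sk _ _ (alpha (beta u)) _ _ (aE _ _ bu) ba).
rewrite (sk _ _ (beta v) _ _ bv ba).
rewrite !(linear_opp (rho3 _ _)) !(linear_scale (rho3 _ _)).
rewrite !(alpha_betaC g_alg); expand_signs.
rewrite -!scaleNr; congr (_ *: _ + _ *: _ + _ *: _); clear.
- by sign_cases.
- by sign_cases.
- by sign_cases.
Qed.

(** Writing [Z.1] and [U.1] as images under [alpha] makes the inner [g]-bracket the image of
    [br (beta z) (beta u) V.1], so [alpha] can be undone on it explicitly. *)
Lemma semidirect_bracket_bbbba (dx dy dz du dv : bool) (X Y Z U V : dsum g M) z u :
  homog dx X -> homog dy Y -> homog dz Z -> homog du U -> homog dv V ->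
  alpha z = Z.1 -> alpha u = U.1 ->
  sbr (betaD (betaD X)) (betaD (betaD Y))
    (sbr (betaD Z) (betaD U) (alphaD V)) =
  (br (beta (beta X.1)) (beta (beta Y.1))
     (br (beta Z.1) (beta U.1) (alpha V.1)),
   nested_rho X.1 Y.1 Z.1 U.1 V.2
   - (-1) ^+ (du * dv)%N *: nested_rho X.1 Y.1 Z.1 V.1 U.2
   + (-1) ^+ (dz * (du + dv))%N *: nested_rho X.1 Y.1 U.1 V.1 Z.2
   - (-1) ^+ (dy * (dz + du + dv))%N *: rho_nested_br X.1 z u V.1 Y.2
   + (-1) ^+ (dx * (dy + (dz + du + dv)))%N *: rho_nested_br Y.1 z u V.1 X.2).
Proof.
move=> Xh Yh Zh Uh Vh zZ uU.
have Nh := semidirect_bracket_even (bDE Zh) (bDE Uh) (aDE Vh).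
have E := semidirect_bracketE _ _ g_alg M_rep indep
  (bDE (bDE Xh)) (bDE (bDE Yh)) Nh.
rewrite E semidirect_bracket_homogE (semidirect_bracket_bba Zh Uh Vh) /=.
congr pair.
have twE a m : twisted_rho (beta (beta a))
    (br (beta Z.1) (beta U.1) (alpha V.1)) (betaM (betaM m))
    = rho_nested_br a z u V.1 m.
  apply: twisted_rhoE => //.
  rewrite (alpha_br g_alg) (beta_br g_alg) -!zZ -!uU.
  by rewrite !(alpha_betaC g_alg).
rewrite !twE !(linear_add (rho3 _ _)) (linear_opp (rho3 _ _)).
rewrite !(linear_scale (rho3 _ _)) -!scaleNr.
(* The inner bracket has degree [dz (+) du (+) dv], whereas the stated exponents use the integer
   sum; the parities agree. *)
congr (_ + _ + _ + _ *: _ + _ *: _); clear.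
- by sign_cases.
- by sign_cases.
Qed.

Lemma semidirect_bracket_jacobi (dx dy dz du dv : bool) X Y Z U V :
  homog dx X -> homog dy Y -> homog dz Z -> homog du U -> homog dv V ->
  sbr (betaD (betaD X)) (betaD (betaD Y))
    (sbr (betaD Z) (betaD U) (alphaD V))
  = (-1) ^+ ((du + dv) * (dx + dy + dz))%N *:
      sbr (betaD (betaD U)) (betaD (betaD V))
        (sbr (betaD X) (betaD Y) (alphaD Z))
    - (-1) ^+ ((dz + dv) * (dx + dy) + du * dv)%N *:
      sbr (betaD (betaD Z)) (betaD (betaD V))
        (sbr (betaD X) (betaD Y) (alphaD U))
    + (-1) ^+ ((dz + du) * (dx + dy))%N *:
      sbr (betaD (betaD Z)) (betaD (betaD U))
        (sbr (betaD X) (betaD Y) (alphaD V)).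
Proof.
move=> Xh Yh Zh Uh Vh.
have pre i (W : dsum g M) : homog i W -> exists2 w, homog i w & alpha w = W.1.
  move=> /homog_dsum[W1 _].
  exact: homog_preimage aL (alpha_even g_alg) alphaS W1.
have [[x xh xX] [y yh yY]] := (pre _ _ Xh, pre _ _ Yh).
have [[z zh zZ] [u uh uU]] := (pre _ _ Zh, pre _ _ Uh).
rewrite (semidirect_bracket_bbbba Xh Yh Zh Uh Vh zZ uU).
(* On the right every inner bracket begins with [X] and [Y], so the preimages [x] and [y] serve for
   all three. *)
rewrite (semidirect_bracket_bbbba Uh Vh Xh Yh Zh xX yY).
rewrite (semidirect_bracket_bbbba Zh Vh Xh Yh Uh xX yY).
rewrite (semidirect_bracket_bbbba Zh Uh Xh Yh Vh xX yY).
move: Xh Yh Zh Uh Vh => /homog_dsum[X1 _] /homog_dsum[Y1 _].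
move=> /homog_dsum[Z1 _] /homog_dsum[U1 _] /homog_dsum[V1 _].
congr pair => /=; first exact: (br_jacobi g_alg).
rewrite -xX -yY in X1 Y1 *.
rewrite (nested_rhoE _ xh yh Z1 U1) (nested_rhoE _ xh yh Z1 V1).
rewrite (nested_rhoE _ xh yh U1 V1).
rewrite (rho_nested_brE _ X1 zh uh V1) (rho_nested_brE _ Y1 zh uh V1) zZ uU.
expand_signs; rewrite -!scaleNr.
(* Each bracket on the right contributes five terms. The permutation groups the fifteen by
   [M]-component, in the order [V.2], [U.2], [Z.2], [Y.2], [X.2] of the left side. *)
rewrite [RHS](AC (5*5*5)
  ((11*4*9) * (6*5*14) * (1*10*15) * (2*7*12) * (3*8*13))).
congr (_ + _ + _ + _ + _); congr (_ *: _ + _ *: _ + _ *: _); clear.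
all: by sign_cases.
Qed.

End SemidirectProduct.

Theorem proposition3p2 (K : fieldType) (g M : superspace K)
    (br : g -> g -> g -> g) (alpha beta : g -> g)
    (rho : g -> g -> M -> M) (alphaM betaM : M -> M)
    (g_alg : bihom_lie3_superalgebra br alpha beta)
    (M_rep : representation br alpha beta rho alphaM betaM)
    (alphaS : surjective alpha) (betaMS : surjective betaM)
    (indep : preimage_independent alpha beta rho alphaM betaM) :
  bihom_lie3_superalgebra
    (semidirect_bracket br beta rho alphaM alphaS betaMS)
    (dsum_map alpha alphaM) (dsum_map beta betaM).
Proof.
split.
- exact: semidirect_bracket_linear1.
- exact: semidirect_bracket_linear2.
- exact: semidirect_bracket_linear3.
- exact: semidirect_bracket_even.
- exact: dsum_map_linear (alpha_linear g_alg) (alphaM_linear M_rep).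
- exact: dsum_map_even (alpha_even g_alg) (alphaM_even M_rep).
- exact: dsum_map_linear (beta_linear g_alg) (betaM_linear M_rep).
- exact: dsum_map_even (beta_even g_alg) (betaM_even M_rep).
- move=> X; rewrite /dsum_map /=.
  by rewrite (alpha_betaC g_alg) (alphaM_betaMC M_rep).
- exact: alpha_semidirect_bracket.
- exact: beta_semidirect_bracket.
- exact: semidirect_bracket_skew12.
- exact: semidirect_bracket_skew23.
- exact: semidirect_bracket_jacobi.
Qed.
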